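(* Let $1<\alpha\le 2$, $\theta\in\mathbb{R}$ with $|\theta|\le\min\{\alpha,2-\alpha\}$, $\nu\in\mathbb{R}$, $d>0$ and $T>0$ be constants, and let $g_0,f_1,f_2\in L^2(\mathbb{R})$ be real-valued. For $j=1,2$ let $u_j$ be a solution of $$\frac{\partial u_j(x,t)}{\partial t}=-\nu\frac{\partial u_j(x,t)}{\partial x}+d\,D^\alpha_\theta u_j(x,t)+f_j(x),\quad x\in\mathbb{R},\ t>0,\qquad u_j(x,0)=g_0(x).$$ If $u_1(\cdot,T)=u_2(\cdot,T)$, then $f_1=f_2$ almost everywhere.
   Context: The Fourier transform in $x$ is $\hat h(k)=\int_{-\infty}^{+\infty}h(y)e^{iky}\,dy$ (extended to $L^2(\mathbb{R})$ as usual), with inverse $h(x)=\frac1{2\pi}\int_{-\infty}^{+\infty}\hat h(k)e^{-ikx}\,dk$. The symbol $\psi^\alpha_\theta(k)=|k|^\alpha e^{i\,\mathrm{sign}(k)\,\theta\pi/2}$ is used, with $\psi^\alpha_\theta(0)=0$. The Riesz-Feller fractional derivative $D^\alpha_\theta$ of order $\alpha$ and skewness $\theta$ in the variable $x$ is the operator with Fourier symbol $-\psi^\alpha_\theta$: the Fourier transform of $D^\alpha_\theta c(\cdot,t)$ is $-\psi^\alpha_\theta(k)\hat c(k,t)$. With this convention the Fourier transform of $\partial_x c$ is $-ik\,\hat c$. Solutions of the problem with source $f$ are understood in the Fourier sense: $u(\cdot,t)\in L^2(\mathbb{R})$ for every $t\ge 0$ with $u(\cdot,0)=g_0$, and there is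 a measurable function $\hat u(k,t)$ on $\mathbb{R}\times[0,\infty)$ which for every $t\ge0$ coincides for almost every $k$ with the Fourier transform of $u(\cdot,t)$, and such that for almost every $k$ the map $t\mapsto\hat u(k,t)$ is continuous on $[0,\infty)$, differentiable on $(0,\infty)$, and satisfies $\partial_t\hat u(k,t)=(i\nu k-d\,\psi^\alpha_\theta(k))\hat u(k,t)+\hat f(k)$ for $t>0$, with $\hat u(k,0)=\hat g_0(k)$. The equality $u_1(\cdot,T)=u_2(\cdot,T)$ is equality in $L^2(\mathbb{R})$. *)

(* Defs.v *)
From HB Require Import structures.
From mathcomp Require Import all_boot all_order all_algebra.
From mathcomp Require Import all_classical all_reals all_analysis.
From mathcomp Require Import complex.

Set Implicit Arguments.
Unset Strict Implicit.
Unset Printing Implicit Defensive.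

Import Order.TTheory GRing.Theory Num.Theory.
Import numFieldNormedType.Exports.

Local Open Scope classical_set_scope.
Local Open Scope ring_scope.

Definition expi (R : realType) (x : R) : R[i] := Complex (cos x) (sin x).

(* R[i] carries neither a sigma-algebra nor a normed R-module structure in the
   libraries, so measurability, integration, continuity and differentiation of
   complex-valued functions are taken componentwise. *)

Definition cmeasurable_fun d (T : measurableType d) (R : realType)
    (D : set T) (F : T -> R[i]) : Prop :=
  measurable_fun D (fun x => complex.Re (F x)) /\
  measurable_fun D (fun x => complex.Im (F x)).

Definition cintegral (R : realType) (F : R -> R[i]) : R[i] :=
  Complex (\int[lebesgue_measure]_(y in [set: R]) complex.Re (F y))
          (\int[lebesgue_measure]_(y in [set: R]) complex.Im (F y)).

Definition ccontinuous_in (R : realType) (D : set R) (F : R -> R[i]) : Prop :=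
  {within D, continuous (fun t => complex.Re (F t))} /\
  {within D, continuous (fun t => complex.Im (F t))}.

Definition is_cderive (R : realType) (t : R) (F : R -> R[i]) (l : R[i]) : Prop :=
  is_derive t (1 : R) (fun s => complex.Re (F s)) (complex.Re l) /\
  is_derive t (1 : R) (fun s => complex.Im (F s)) (complex.Im l).

Definition cL2 (R : realType) (h : R -> R[i]) : Prop :=
  (fun x => complex.Re (h x)) \in Lfun (@lebesgue_measure R) 2%:E /\
  (fun x => complex.Im (h x)) \in Lfun (@lebesgue_measure R) 2%:E.

(* The integral defining the Fourier transform; meaningful for integrable h. *)
Definition fourier (R : realType) (h : R -> R[i]) (k : R) : R[i] :=
  cintegral (fun y => h y * expi (k * y)).

Definition truncate (R : realType) (h : R -> R[i]) (n : nat) (y : R) : R[i] :=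
  if y \in `[- n%:R, n%:R] then h y else 0.

(* H is (a representative of) the Fourier transform of h in L2: the L2-limit of
   the transforms of the truncations of h, which lie in L1 and L2 and converge
   to h in L2. By the Plancherel theorem H exists and is unique up to null
   sets. *)
Definition is_fourierL2 (R : realType) (h H : R -> R[i]) : Prop :=
  [/\ cL2 h, cL2 H &
   (fun n : nat => 'N[@lebesgue_measure R]_2%:E[(fun k : R =>
      (ComplexField.Normc.normc (fourier (truncate h n) k - H k)%R)%:E)])%E
     @ \oo --> 0%E].

(* As alpha is nonzero, 0 `^ alpha = 0, so that the symbol vanishes at 0. *)
Definition riesz_feller_symbol (R : realType) (alpha theta k : R) : R[i] :=
  (`|k| `^ alpha)%:C%C * expi (Num.sg k * (theta * pi / 2)).

(* Solution, in the Fourier sense, of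
     u_t = - nu u_x + d D^alpha_theta u + f,  u(., 0) = g0,
   where D^alpha_theta is the Riesz-Feller derivative, whose Fourier symbol is
   - riesz_feller_symbol alpha theta, and d/dx has Fourier symbol - i k. Only
   the values u x t and uh k t with 0 <= t matter. *)
Definition is_solution (R : realType) (alpha theta nu d : R) (g0 f : R -> R)
    (u : R -> R -> R[i]) : Prop :=
  [/\ (forall t : R, 0 <= t -> cL2 (fun x => u x t)),
      (fun x => u x 0) = (fun x => (g0 x)%:C%C) %[ae @lebesgue_measure R] &
      exists uh : R -> R -> R[i], exists g0h : R -> R[i], exists fh : R -> R[i],
      [/\ is_fourierL2 (fun x => (g0 x)%:C%C) g0h,
          is_fourierL2 (fun x => (f x)%:C%C) fh,
          cmeasurable_fun ([set: R] `*` `[0 : R, +oo[)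
            (fun kt : R * R => uh kt.1 kt.2),
          (forall t : R, 0 <= t ->
             is_fourierL2 (fun x => u x t) (fun k => uh k t)) &
          \forall k \ae @lebesgue_measure R,
            [/\ ccontinuous_in `[0, +oo[ (uh k),
                (forall t : R, 0 < t ->
                   is_cderive t (uh k)
                     ((Complex 0 (nu * k)
                       - d%:C%C * riesz_feller_symbol alpha theta k) * uh k t
                      + fh k)) &
                uh k 0 = g0h k]]].

(* Main.v *)
(* Fix a frequency k. The difference w of the two transforms solves
   w' = a w + F with F = fh1 - fh2, w(0) = w(T) = 0, and
   Re a = - d |k|^alpha cos (theta pi / 2) < 0 for k <> 0, because
   |theta| <= 2 - alpha < 1; this forces F = 0. So f1 and f2 have the same
   Fourier transform, and it remains to see that the transform is injective on
   L2. If the transforms of the truncations h_n of h tend to 0 in L2, pair them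
   with a modulated exponential exp (- e k) on k >= 0: by Fubini the Poisson integrals of
   h_n at height e tend to 0, uniformly in the base point. Integrating the base
   point over [a, b] turns the Poisson kernel into a difference of arctangents,
   which tends to pi times the indicator of [a, b] as e -> 0. Hence all integrals
   of h over intervals vanish. *)

Require Import Defs.
From HB Require Import structures.
From mathcomp Require Import all_boot all_order all_algebra.
From mathcomp Require Import all_classical all_reals all_analysis.
From mathcomp Require Import complex.
From mathcomp Require Import measurable_realfun ring lra.

Set Implicit Arguments.
Unset Strict Implicit.
Unset Printing Implicit Defensive.

Import Order.TTheory GRing.Theory Num.Theory.
Import numFieldNormedType.Exports.

Local Open Scope classical_set_scope.
Local Open Scope ring_scope.

(** * Norms and integrals *)

Lemma measurable_fun_cos d (T : measurableType d) (R : realType) (f : T -> R) :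
  measurable_fun [set: T] f -> measurable_fun [set: T] (fun x => cos (f x)).
Proof.
exact: (measurableT_comp (continuous_measurable_fun (@continuous_cos R))).
Qed.

Lemma measurable_fun_sin d (T : measurableType d) (R : realType) (f : T -> R) :
  measurable_fun [set: T] f -> measurable_fun [set: T] (fun x => sin (f x)).
Proof.
exact: (measurableT_comp (continuous_measurable_fun (@continuous_sin R))).
Qed.

Lemma lebesgue_ae_neq (R : realType) (c : R) :
  {ae @lebesgue_measure R, forall x : R, x != c}.
Proof.
exists [set c]; split => //; first exact: lebesgue_measure_set1.
by move=> x /= /negP; rewrite negbK => /eqP.
Qed.

Lemma measurable_normr_powR d (T : measurableType d) (R : realType)
    (f : T -> R) (p : R) :
  measurable_fun [set: T] f -> measurable_fun [set: T] (fun x => `|f x| `^ p).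
Proof.
move=> mf; apply: (@measurableT_comp _ _ _ _ _ _ (fun x : R => x `^ p)) => //.
exact: measurableT_comp.
Qed.

Lemma le_Lnorm2 d (T : measurableType d) (R : realType)
    (mu : {measure set T -> \bar R}) (f g : T -> R) :
  measurable_fun [set: T] f -> measurable_fun [set: T] g ->
  (forall x, `|f x| <= `|g x|) ->
  ('N[mu]_2%:E[EFin \o f] <= 'N[mu]_2%:E[EFin \o g])%E.
Proof.
move=> mf mg fg; rewrite unlock gt0_ler_poweR ?invr_ge0 ?ler0n//.
- by rewrite in_itv/= leey integral_ge0.
- by rewrite in_itv/= leey integral_ge0.
- apply: ge0_le_integral => //=.
  + by apply/measurable_EFinP; exact: measurable_normr_powR.
  + by apply/measurable_EFinP; exact: measurable_normr_powR.
  + by move=> x _ /=; rewrite lee_fin ge0_ler_powR.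
Qed.

Lemma Lnorm2_subC d (T : measurableType d) (R : realType)
    (mu : {measure set T -> \bar R}) (f g : T -> R) :
  ('N[mu]_2%:E[EFin \o (f \- g)%R] = 'N[mu]_2%:E[EFin \o (g \- f)%R])%E.
Proof.
have -> : EFin \o (f \- g)%R = (\- (EFin \o (g \- f)%R))%E.
  by apply/funext => x /=; congr EFin; rewrite opprB.
exact: oppe_Lnorm.
Qed.

Lemma ae_eq_Lnorm2 d (T : measurableType d) (R : realType)
    (mu : {measure set T -> \bar R}) (f g : T -> R) :
  measurable_fun [set: T] f -> measurable_fun [set: T] g ->
  f = g %[ae mu] ->
  ('N[mu]_2%:E[EFin \o f] = 'N[mu]_2%:E[EFin \o g])%E.
Proof.
move=> mf mg fg; rewrite unlock; congr (_ `^ _)%E; apply: ae_eq_integral => //=.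
- by apply/measurable_EFinP; exact: measurable_normr_powR.
- by apply/measurable_EFinP; exact: measurable_normr_powR.
- by apply: filterS fg => x /(_ I) + _ => ->.
Qed.

Lemma Lnorm2_subr d (T : measurableType d) (R : realType)
    (mu : {measure set T -> \bar R}) (f g h : T -> R) :
  measurable_fun [set: T] f -> measurable_fun [set: T] g ->
  measurable_fun [set: T] h ->
  ('N[mu]_2%:E[EFin \o (f \- g)%R] <=
   'N[mu]_2%:E[EFin \o (h \- f)%R] + 'N[mu]_2%:E[EFin \o (h \- g)%R])%E.
Proof.
move=> mf mg mh.
have -> : (f \- g = (f \- h) \+ (h \- g))%R.
  by apply/funext => x /=; rewrite addrA subrK.
apply: le_trans (minkowski_EFin _ _ _ _) _ => //.
- exact: measurable_funB.
- exact: measurable_funB.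
- by rewrite ler1n.
by rewrite leeD// Lnorm2_subC.
Qed.

(** The norm of [f \- g] does not depend on [n], and Minkowski's inequality bounds it by a sum that
    tends to 0. *)
Lemma Lnorm2_cvg_unique d (T : measurableType d) (R : realType)
    (mu : {measure set T -> \bar R}) (F_ : nat -> T -> R) (f g : T -> R) :
  (forall n, measurable_fun [set: T] (F_ n)) ->
  measurable_fun [set: T] f -> measurable_fun [set: T] g ->
  ('N[mu]_2%:E[EFin \o (F_ n \- f)%R])%E @[n --> \oo] --> 0%E ->
  ('N[mu]_2%:E[EFin \o (F_ n \- g)%R])%E @[n --> \oo] --> 0%E ->
  f = g %[ae mu].
Proof.
move=> mF mf mg Ff Fg.
have fg0 : ('N[mu]_2%:E[EFin \o (f \- g)%R] = 0)%E.
  apply/eqP; rewrite eq_le Lnorm_ge0 andbT.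
  have := cvgeD _ Ff Fg; rewrite adde0 => /(_ _ isT) FD.
  by apply: (cvge_ge _ FD); apply: nearW => n; exact: Lnorm2_subr.
have := Lnorm_eq0_eq0 _ _ fg0.
have mfg : measurable_fun [set: T] (EFin \o (f \- g)%R).
  by apply/measurable_EFinP; exact: measurable_funB.
move=> /(_ mfg); rewrite lte_fin ltr0n => /(_ isT).
by apply: filterS => x /= /(_ I) [] /eqP; rewrite subr_eq0 => /eqP.
Qed.

(** Tonelli applies to the positive and negative parts separately, so the parametric integral is
    measurable even across parameters where it diverges; there [fine] turns infinite values into
    0. *)
Lemma measurable_fun_Rintegral d1 d2 (T1 : measurableType d1)
    (T2 : measurableType d2) (R : realType)
    (mu : {sigma_finite_measure set T2 -> \bar R}) (f : T1 * T2 -> R) :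
  measurable_fun [set: T1 * T2] f ->
  measurable_fun [set: T1] (fun x => \int[mu]_y f (x, y)).
Proof.
move=> mf; rewrite /Rintegral; apply: measurableT_comp => //.
have mEf : measurable_fun [set: T1 * T2] (EFin \o f) by exact/measurable_EFinP.
rewrite (_ : (fun x => _) = (fun x => \int[mu]_y (EFin \o f)^\+ (x, y) -
                                      \int[mu]_y (EFin \o f)^\- (x, y)))%E.
  apply: emeasurable_funB.
  - by apply: measurable_fun_fubini_tonelli_F => //; exact: measurable_funepos.
  - by apply: measurable_fun_fubini_tonelli_F => //; exact: measurable_funeneg.
apply/funext => x; rewrite [LHS]integralE.
by congr (_ - _)%E; apply: eq_integral => y _; rewrite ?funeposE ?funenegE.
Qed.

Lemma integrableM_bounded d (T : measurableType d) (R : realType)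
    (mu : {measure set T -> \bar R}) (g k : T -> R) (M : R) :
  mu.-integrable [set: T] (EFin \o g) -> measurable_fun [set: T] k ->
  (forall x, `|k x| <= M) ->
  mu.-integrable [set: T] (EFin \o (g \* k)%R).
Proof.
move=> ig mk kM.
have := integrableMl measurableT ig mk; rewrite /= => H.
rewrite (_ : EFin \o _ = (EFin \o g) \* (EFin \o k))%E; last first.
  by apply/funext => x /=; rewrite EFinM.
apply: H; exists M; split; first by rewrite num_real.
by move=> x Mx y _ /=; rewrite (le_trans (kM y))// ltW.
Qed.

(** Fubini applies because the kernel is bounded by 1: the integrand is dominated by the tensor
    product of [|f|] and [|g|], whose double integral is a product of two finite integrals. *)
Lemma Rintegral_swap d1 d2 (T1 : measurableType d1) (T2 : measurableType d2)
    (R : realType) (m1 : {sigma_finite_measure set T1 -> \bar R})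
    (m2 : {sigma_finite_measure set T2 -> \bar R})
    (f : T1 -> R) (g : T2 -> R) (K : T1 * T2 -> R) :
  m1.-integrable [set: T1] (EFin \o f) -> m2.-integrable [set: T2] (EFin \o g) ->
  measurable_fun [set: T1 * T2] K -> (forall z, `|K z| <= 1) ->
  \int[m1]_x (f x * \int[m2]_y (g y * K (x, y))) =
  \int[m2]_y (g y * \int[m1]_x (f x * K (x, y))).
Proof.
move=> intf intg mK K1.
have mf : measurable_fun [set: T1] f.
  by apply/measurable_EFinP; exact: measurable_int intf.
have mg : measurable_fun [set: T2] g.
  by apply/measurable_EFinP; exact: measurable_int intg.
have igK x : m2.-integrable [set: T2] (EFin \o (fun y => g y * K (x, y))).
  apply: integrableM_bounded (fun y => K1 (x, y)) => //.
  exact: measurableT_comp.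
have ifK y : m1.-integrable [set: T1] (EFin \o (fun x => f x * K (x, y))).
  apply: integrableM_bounded (fun x => K1 (x, y)) => //.
  exact: measurableT_comp.
pose F z := f z.1 * (g z.2 * K z).
have mF : measurable_fun [set: T1 * T2] F.
  apply: measurable_funM; first exact: measurableT_comp.
  by apply: measurable_funM => //; exact: measurableT_comp.
have intF : (m1 \x m2)%E.-integrable [set: T1 * T2] (EFin \o F).
  apply/integrable12ltyP; first exact/measurable_EFinP.
  apply: (@le_lt_trans _ _ (\int[m1]_x (`|f x|%:E * \int[m2]_y `|g y|%:E))%E).
    apply: ge0_le_integral => //=.
    - by move=> x _; exact: integral_ge0.
    - apply: (@measurable_fun_fubini_tonelli_F _ _ _ _ _ m2 (abse \o (EFin \o F))).
      + by apply: measurableT_comp => //; exact/measurable_EFinP.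
      + by move=> z; exact: abse_ge0.
    - by apply: emeasurable_funM => //; apply/measurable_EFinP; exact: measurableT_comp.
    - move=> x _; rewrite -ge0_integralZl//.
      + apply: ge0_le_integral => //=.
        * apply/measurable_EFinP; do 2 apply: measurableT_comp => //.
        * by apply/measurable_EFinP; apply: measurable_funM => //; exact: measurableT_comp.
        * move=> y _; rewrite -EFinM lee_fin /F /= !normrM ler_wpM2l//.
          by rewrite ler_piMr.
      + by apply/measurable_EFinP; exact: measurableT_comp.
  rewrite ge0_integralZr//.
  - case/integrableP : intf => _ /=; case/integrableP : intg => _ /= gy fy.
    apply: lte_mul_pinfty => //; first exact: integral_ge0.
    by rewrite ge0_fin_numE//; exact: integral_ge0.
  - by apply/measurable_EFinP; exact: measurableT_comp.
  - exact: integral_ge0.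
transitivity (fine (\int[m1]_x \int[m2]_y (F (x, y))%:E)).
  congr fine; apply: eq_integral => x _.
  rewrite /Rintegral EFinM fineK; last exact: (integrable_fin_num measurableT (igK x)).
  by rewrite -(integralZl measurableT (igK x)).
rewrite (Fubini intF).
congr fine; apply: eq_integral => y _.
rewrite /Rintegral EFinM fineK; last exact: (integrable_fin_num measurableT (ifK y)).
rewrite -(integralZl measurableT (ifK y)); apply: eq_integral => x _.
by rewrite /F /= -EFinM mulrCA.
Qed.

(** * Uniqueness of the Fourier transform *)

Lemma normcE (R : rcfType) (z : R[i]) :
  ComplexField.Normc.normc z = Num.sqrt (complex.Re z ^+ 2 + complex.Im z ^+ 2).
Proof. by case: z. Qed.

Lemma ler_Re_normc (R : rcfType) (z : R[i]) :
  `|complex.Re z| <= `|ComplexField.Normc.normc z|.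
Proof.
by rewrite normcE -sqrtr_sqr ger0_norm ?sqrtr_ge0// ler_wsqrtr// lerDl sqr_ge0.
Qed.

Lemma ler_Im_normc (R : rcfType) (z : R[i]) :
  `|complex.Im z| <= `|ComplexField.Normc.normc z|.
Proof.
by rewrite normcE -sqrtr_sqr ger0_norm ?sqrtr_ge0// ler_wsqrtr// lerDr sqr_ge0.
Qed.

Lemma complex_ReB (R : rcfType) (z w : R[i]) :
  complex.Re (z - w) = complex.Re z - complex.Re w.
Proof. by case: z; case: w. Qed.

Lemma complex_ImB (R : rcfType) (z w : R[i]) :
  complex.Im (z - w) = complex.Im z - complex.Im w.
Proof. by case: z; case: w. Qed.

Lemma complex_ReM (R : rcfType) (z w : R[i]) : complex.Re (z * w) =
  complex.Re z * complex.Re w - complex.Im z * complex.Im w.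
Proof. by case: z; case: w. Qed.

Lemma complex_ImM (R : rcfType) (z w : R[i]) : complex.Im (z * w) =
  complex.Re z * complex.Im w + complex.Im z * complex.Re w.
Proof. by case: z; case: w. Qed.

Lemma measurable_sin_cos_mul (R : realType) :
  measurable_fun [set: R * R] (fun z : R * R => cos (z.1 * z.2)) /\
  measurable_fun [set: R * R] (fun z : R * R => sin (z.1 * z.2)).
Proof.
split.
- by apply: measurable_fun_cos; exact: measurable_funM.
- by apply: measurable_fun_sin; exact: measurable_funM.
Qed.

Lemma measurable_fourier (R : realType) (h : R -> R[i]) :
  cmeasurable_fun [set: R] h -> cmeasurable_fun [set: R] (fourier h).
Proof.
move=> [mr mi]; have [mc ms] := measurable_sin_cos_mul R.
have mr2 : measurable_fun [set: R * R] (fun z : R * R => complex.Re (h z.2)).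
  exact: (measurableT_comp mr).
have mi2 : measurable_fun [set: R * R] (fun z : R * R => complex.Im (h z.2)).
  exact: (measurableT_comp mi).
rewrite /fourier /cintegral; split => /=.
- apply: (@measurable_fun_Rintegral _ _ (measurableTypeR R) (measurableTypeR R)
    _ (@lebesgue_measure R) (fun z => complex.Re (h z.2 * expi (z.1 * z.2)))).
  under eq_fun do rewrite complex_ReM /=.
  by apply: measurable_funB; apply: measurable_funM.
- apply: (@measurable_fun_Rintegral _ _ (measurableTypeR R) (measurableTypeR R)
    _ (@lebesgue_measure R) (fun z => complex.Im (h z.2 * expi (z.1 * z.2)))).
  under eq_fun do rewrite complex_ImM /=.
  by apply: measurable_funD; apply: measurable_funM.
Qed.

Lemma measurable_truncate (R : realType) (h : R -> R[i]) (n : nat) :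
  cmeasurable_fun [set: R] h -> cmeasurable_fun [set: R] (truncate h n).
Proof.
move=> [mr mi].
have mI : measurable_fun [set: R] (fun y : R => y \in `[- n%:R, n%:R]).
  by apply: (measurable_fun_bool true); rewrite setTI; exact: measurable_itv.
split; rewrite /truncate.
- by under eq_fun do rewrite (fun_if (@complex.Re R)) /=; exact: measurable_fun_ifT.
- by under eq_fun do rewrite (fun_if (@complex.Im R)) /=; exact: measurable_fun_ifT.
Qed.

Lemma cL2_measurable (R : realType) (h : R -> R[i]) :
  cL2 h -> cmeasurable_fun [set: R] h.
Proof. by move=> [/sub_Lfun_mfun /set_mem ? /sub_Lfun_mfun /set_mem ?]. Qed.

(** The modulus dominates both components, so the convergence of one complex sequence yields that of
    two real ones, to which the L2 lemmas above apply. *)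
Lemma is_fourierL2_cvg (R : realType) (h H : R -> R[i]) : is_fourierL2 h H ->
  ('N[@lebesgue_measure R]_2%:E[EFin \o ((fun k : R =>
      complex.Re (fourier (truncate h n) k)) \- (fun k => complex.Re (H k)))%R])%E
    @[n --> \oo] --> 0%E /\
  ('N[@lebesgue_measure R]_2%:E[EFin \o ((fun k : R =>
      complex.Im (fourier (truncate h n) k)) \- (fun k => complex.Im (H k)))%R])%E
    @[n --> \oo] --> 0%E.
Proof.
move=> [/cL2_measurable mh /cL2_measurable [mHr mHi] cv].
have mF n : cmeasurable_fun [set: R] (fourier (truncate h n)).
  by apply: measurable_fourier; exact: measurable_truncate.
have mN n : measurable_fun [set: R]
    (fun k => ComplexField.Normc.normc (fourier (truncate h n) k - H k)).
  under eq_fun do rewrite normcE complex_ReB complex_ImB.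
  apply: (measurableT_comp (continuous_measurable_fun (@sqrt_continuous R))).
  by apply: measurable_funD; apply: measurable_funX; apply: measurable_funB => //;
     have [] := mF n.
split; apply: (squeeze_cvge _ (cvg_cst _) cv); apply: nearW => n;
  rewrite Lnorm_ge0/=; apply: le_Lnorm2 => //.
- by apply: measurable_funB => //; have [] := mF n.
- exact: mN.
- move=> k.
  by have := ler_Re_normc (fourier (truncate h n) k - H k); rewrite complex_ReB.
- by apply: measurable_funB => //; have [] := mF n.
- exact: mN.
- move=> k.
  by have := ler_Im_normc (fourier (truncate h n) k - H k); rewrite complex_ImB.
Qed.

(** A null set does not change an integral, so the two transforms agree at every frequency and not
    merely at almost every one. *)
Lemma ae_eq_fourier_truncate (R : realType) (h1 h2 : R -> R[i]) (n : nat) :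
  cmeasurable_fun [set: R] h1 -> cmeasurable_fun [set: R] h2 ->
  h1 = h2 %[ae @lebesgue_measure R] ->
  fourier (truncate h1 n) = fourier (truncate h2 n).
Proof.
move=> m1 m2 h12; have [m1r m1i] := measurable_truncate n m1.
have [m2r m2i] := measurable_truncate n m2.
apply/funext => k.
have mc : measurable_fun [set: R] (fun y : R => cos (k * y)).
  by apply: measurable_fun_cos; exact: measurable_funM.
have ms : measurable_fun [set: R] (fun y : R => sin (k * y)).
  by apply: measurable_fun_sin; exact: measurable_funM.
have FF := ae_filter_ringOfSetsType (@lebesgue_measure R).
congr Complex; congr fine; apply: ae_eq_integral => //; try apply/measurable_EFinP.
- under eq_fun do rewrite complex_ReM /=.
  by apply: measurable_funB; apply: measurable_funM.
- under eq_fun do rewrite complex_ReM /=.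
  by apply: measurable_funB; apply: measurable_funM.
- by apply: filterS h12 => y /(_ I) e _; rewrite /truncate e.
- under eq_fun do rewrite complex_ImM /=.
  by apply: measurable_funD; apply: measurable_funM.
- under eq_fun do rewrite complex_ImM /=.
  by apply: measurable_funD; apply: measurable_funM.
- by apply: filterS h12 => y /(_ I) e _; rewrite /truncate e.
Qed.

(** Both transforms are L2 limits of one and the same sequence, that of the truncations. *)
Lemma is_fourierL2_unique (R : realType) (h1 h2 H1 H2 : R -> R[i]) :
  is_fourierL2 h1 H1 -> is_fourierL2 h2 H2 ->
  h1 = h2 %[ae @lebesgue_measure R] -> H1 = H2 %[ae @lebesgue_measure R].
Proof.
move=> F1 F2 h12.
have [[cr1 ci1] [cr2 ci2]] := (is_fourierL2_cvg F1, is_fourierL2_cvg F2).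
have [/cL2_measurable m1 /cL2_measurable [mH1r mH1i] _] := F1.
have [/cL2_measurable m2 /cL2_measurable [mH2r mH2i] _] := F2.
have mF n : cmeasurable_fun [set: R] (fourier (truncate h1 n)).
  by apply: measurable_fourier; exact: measurable_truncate.
have FE n : fourier (truncate h2 n) = fourier (truncate h1 n).
  by apply/esym; exact: ae_eq_fourier_truncate.
move: cr2; under eq_cvg do rewrite FE; move=> cr2.
move: ci2; under eq_cvg do rewrite FE; move=> ci2.
have re := @Lnorm2_cvg_unique _ _ _ (@lebesgue_measure R) _ _ _
  (fun n => (mF n).1) mH1r mH2r cr1 cr2.
have im := @Lnorm2_cvg_unique _ _ _ (@lebesgue_measure R) _ _ _
  (fun n => (mF n).2) mH1i mH2i ci1 ci2.
apply: filterS2 re im => k /(_ I) /= rE /(_ I) /= iE _.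
by move: rE iE; case: (H1 k) => ? ?; case: (H2 k) => ? ? /= -> ->.
Qed.

(** * Injectivity of the Fourier transform *)

(** This is the Laplace transform of a cosine. As the exponential density carries a factor [e], the
    value is [pi * e] times the Poisson kernel at height [e]. *)
Lemma Rintegral_exponential_cos (R : realType) (e z : R) : 0 < e ->
  \int[lebesgue_measure]_k (exponential_pdf e k * cos (k * z)) =
  e ^+ 2 / (e ^+ 2 + z ^+ 2).
Proof.
move=> e0; set D := e ^+ 2 + z ^+ 2.
have D0 : D != 0 by rewrite gt_eqF// ltr_wpDr ?sqr_ge0// exprn_gt0.
have mcos : measurable_fun [set: R] (fun k : R => cos (k * z)).
  by apply: measurable_fun_cos; exact: measurable_funM.
have ipdf := integrable_exponential_pdf e0.
have ipc : lebesgue_measure.-integrable [set: R]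
    (EFin \o (fun k => exponential_pdf e k * cos (k * z))).
  by apply: (integrableM_bounded (M := 1) ipdf mcos) => k; exact: cos_max.
have pdf1 : \int[lebesgue_measure]_k exponential_pdf e k = 1.
  by rewrite /Rintegral integral_exponential_pdf.
(* The improper FTC in the library needs a nonnegative integrand, hence 1 + cos. *)
suff : \int[lebesgue_measure]_k (exponential_pdf e k + exponential_pdf e k * cos (k * z))
    = 1 + e ^+ 2 / D.
  by rewrite RintegralD// pdf1 => /addrI.
pose f k := e * expR (- e * k) * (1 + cos (k * z)).
(* The antiderivative of [f] that vanishes at infinity, obtained by two integrations by parts; [F 0]
   is [- 1 - e ^+ 2 / D]. *)
pose F k := - expR (- e * k) +
  e / D * (expR (- e * k) * (z * sin (k * z) - e * cos (k * z))).
rewrite (_ : (fun k => _) = f \_ `[0, +oo[); last first.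
  apply/funext => k; rewrite /exponential_pdf !patchE; case: ifP => _.
    by rewrite /f mulrDr mulr1.
  by rewrite mul0r addr0.
rewrite -Rintegral_mkcond.
have dF (k : R) : is_derive k (1 : R) F (f k).
  rewrite /F /f; apply: is_derive_eq; rewrite /GRing.scale /=.
  rewrite -/D /D in D0 *; field.
  exact: D0.
have cF : continuous F.
  move=> k; apply/differentiable_continuous/derivable1_diffP.
  by have [] := dF k.
have cexp : expR (- e * k) @[k --> +oo] --> (0 : R).
  rewrite (_ : (fun x => expR (- e * x)) =
               (fun z => expR (- z)) \o (fun z => e * z)); last first.
    by apply/funext => x; rewrite mulNr.
  apply: (@cvg_comp _ _ _ _ _ _ (pinfty_nbhs R)); last exact: cvgr_expR.
  exact: gt0_cvgMry.
rewrite (@Rintegral_ge0_continuous_FTC2y _ f F 0 0).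
- by rewrite /F mul0r mulr0 expR0 sin0 cos0; ring.
- move=> k _; apply: mulr_ge0; first by rewrite mulr_ge0 ?expR_ge0 ?ltW.
  by have := cos_geN1 (k * z); lra.
- apply: continuous_subspaceT => k.
  by apply/differentiable_continuous/derivable1_diffP; exact: ex_derive.
(* Since sine and cosine are at most 1 in modulus, [C] bounds the oscillating factor of the
   exponential in [F]. *)
- pose C := 1 + e / D * (`|z| + e).
  have cC : C * expR (- e * k) @[k --> +oo] --> (0 : R).
    by rewrite -[X in _ --> X](mulr0 C); apply: cvgM (cvg_cst _) cexp.
  apply/norm_cvg0P; apply: (squeeze_cvgr _ (cvg_cst _) cC).
  apply: nearW => k; rewrite normr_ge0/=.
  have -> : F k = (- 1 + e / D * (z * sin (k * z) - e * cos (k * z))) * expR (- e * k).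
    by rewrite /F; ring.
  rewrite normrM (ger0_norm (expR_ge0 _)) ler_wpM2r ?expR_ge0//.
  rewrite (le_trans (ler_normD _ _))// normrN1 lerD2l normrM.
  have eD : 0 <= e / D by rewrite divr_ge0 ?(ltW e0)// /D addr_ge0 ?sqr_ge0.
  rewrite (ger0_norm eD) ler_wpM2l// (le_trans (ler_normB _ _))// lerD// normrM.
    by rewrite ler_piMr// sin_max.
  by rewrite (gtr0_norm e0) ler_piMr ?(ltW e0)// cos_max.
- by move=> k _; have [] := dF k.
- by apply: cvg_at_right_filter; exact: cF.
- by move=> k _; rewrite derive1E; exact: (@derive_val _ _ _ _ _ _ _ (dF k)).
Qed.

(** Almost every point is a Lebesgue point of [h], and there [h] is the derivative of its primitive,
    which vanishes identically. *)
Lemma ae_eq0_Rintegral_itv (R : realType) (h : R -> R) :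
  (forall a b, lebesgue_measure.-integrable `[a, b] (EFin \o h)) ->
  measurable_fun [set: R] h ->
  (forall a b, a < b -> \int[lebesgue_measure]_(x in `[a, b]) h x = 0) ->
  h = (fun=> 0) %[ae @lebesgue_measure R].
Proof.
move=> ih mh h0.
have lh : locally_integrable [set: R] h.
  split => //; first exact: openT.
  move=> K _ cK; have [M [_ MK]] := compact_bounded cK.
  have KM : K `<=` `[- (M + 1), M + 1].
    by move=> x /(MK (M + 1) _); rewrite ltrDl ltr01 /= in_itv/= -ler_norml => ->.
  have /integrableP[_ /=] := ih (- (M + 1)) (M + 1); apply: le_lt_trans.
  apply: ge0_subset_integral => //; first exact: compact_measurable.
  apply/measurable_EFinP; apply: measurableT_comp => //.
  exact: measurable_funTS.
have FF := ae_filter_ringOfSetsType (@lebesgue_measure R).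
apply: filterS (lebesgue_differentiation lh) => x lx _.
have xx1 : x < x + 1 by rewrite ltrDl.
have := @FTC1_lebesgue_pt _ _ (BLeft (x - 1)) _ _ xx1 (ih _ _).
rewrite /= lte_fin => /(_ _ lx)[|_ <-]; first by rewrite gtrBl.
(* The primitive based at [x - 1] vanishes at every [y]: by hypothesis to the right of the base
   point, over a single point at it, and over an empty interval to its left. *)
rewrite (_ : (fun y => _) = cst 0) ?derive1_cst//.
apply/funext => y /=; have [xy|yx] := ltP (x - 1) y; first exact: h0.
move: yx; rewrite le_eqVlt => /orP[/eqP ->|yx].
  by rewrite set_itv1 Rintegral_set1.
by rewrite set_itv_ge ?Rintegral_set0// bnd_simp -ltNge.
Qed.

(** * Arctangent windows: the Poisson kernel integrated over an interval *)

Lemma integrable_oneDsqrV (R : realType) :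
  lebesgue_measure.-integrable [set: R] (EFin \o (fun y : R => (1 + y ^+ 2)^-1)).
Proof.
have mo : measurable_fun [set: R] (fun y : R => (1 + y ^+ 2)^-1).
  exact: continuous_measurable_fun (@continuous_oneDsqrV R).
have o0 (x : R) : 0 <= (1 + x ^+ 2)^-1 by rewrite invr_ge0 addr_ge0 ?sqr_ge0.
apply/integrableP; split; first exact/measurable_EFinP.
rewrite /=; under eq_integral do rewrite ger0_norm//.
rewrite ge0_symfun_integralT//.
- rewrite (_ : [set x | _] = `[0, +oo[%classic); last first.
    by apply/seteqP; split => x /=; rewrite in_itv/= andbT.
  by have := integral0y_oneDsqr R; rewrite /oneDsqr => ->; rewrite -EFinM ltry.
- exact: continuous_oneDsqrV.
- by move=> x /=; rewrite sqrrN.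
Qed.

(** For [0 < e] and [a < b] this is [pi] times the harmonic measure of [[a, b]] seen from the point
    of abscissa [y] and height [e] in the upper half-plane. *)
Definition atan_window (R : realType) (a b e y : R) : R :=
  atan ((b - y) / e) - atan ((a - y) / e).

Lemma continuous_atan_window (R : realType) (a b e : R) :
  continuous (atan_window a b e).
Proof.
move=> y; apply: cvgB.
- apply: continuous_comp; last exact: continuous_atan.
  by apply: cvgM (cvg_cst _); apply: cvgB (cvg_cst _) cvg_id.
- apply: continuous_comp; last exact: continuous_atan.
  by apply: cvgM (cvg_cst _); apply: cvgB (cvg_cst _) cvg_id.
Qed.

Lemma atan_window_ge0 (R : realType) (a b e y : R) : 0 < e -> a <= b ->
  0 <= atan_window a b e y.
Proof.
by move=> e0 ab; rewrite subr_ge0 le_atan// ler_pM2r ?invr_gt0// lerB.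
Qed.

Lemma atan_window_le_pi (R : realType) (a b e y : R) : atan_window a b e y <= pi.
Proof.
by rewrite /atan_window; have := atan_ltpi2 ((b - y) / e);
  have := atan_gtNpi2 ((a - y) / e); lra.
Qed.

Lemma is_derive_atan_scaled (R : realType) (y e x : R) : 0 < e ->
  is_derive x (1 : R) (fun x => e * atan ((x - y) / e))
    (e ^+ 2 / (e ^+ 2 + (y - x) ^+ 2)).
Proof.
move=> e0; apply: is_derive_eq; rewrite /GRing.scale /=.
field; rewrite ?gt_eqF//.
by rewrite ltr_wpDr ?sqr_ge0// exprn_gt0.
Qed.

Lemma Rintegral_poisson_kernel (R : realType) (a b e y : R) : 0 < e -> a < b ->
  \int[lebesgue_measure]_(x in `[a, b]) (e ^+ 2 / (e ^+ 2 + (y - x) ^+ 2)) =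
  e * atan_window a b e y.
Proof.
move=> e0 ab; have dF x := @is_derive_atan_scaled R y e x e0.
pose F (x : R) := e * atan ((x - y) / e).
have cF : continuous F.
  by move=> x; apply/differentiable_continuous/derivable1_diffP; have [] := dF x.
rewrite /Rintegral (@continuous_FTC2 _ _ F)//.
- by rewrite /F /atan_window /= mulrBr.
- apply: continuous_subspaceT => x; apply: cvgM (cvg_cst _) _.
  apply: cvgV; first by rewrite gt_eqF// ltr_wpDr ?sqr_ge0// exprn_gt0.
  apply: cvgD (cvg_cst _) _; rewrite expr2.
  under eq_fun do rewrite expr2.
  by apply: cvgM; apply: cvgB (cvg_cst _) cvg_id.
- split.
  + by move=> x _; have [] := dF x.
  + by apply: cvg_at_right_filter; exact: cF.
  + by apply: cvg_at_left_filter; exact: cF.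
- by move=> x _; rewrite derive1E; exact: (@derive_val _ _ _ _ _ _ _ (dF x)).
Qed.

(** The constant is uniform in the height, so the same dominating function serves both limits below:
    removing the truncation at a fixed height, and letting the height tend to 0. *)
Lemma atan_window_bound (R : realType) (a b : R) : a < b ->
  exists2 C : R, 0 <= C & forall e y, 0 < e -> e <= 1 ->
    `|atan_window a b e y| <= C * (1 + y ^+ 2)^-1.
Proof.
move=> ab; pose M := 1 + `|a| + `|b|.
have M1 : 1 <= M by rewrite /M -addrA lerDl addr_ge0.
(* The first term serves [|y| <= 2 * M], where the window is at most [pi] and [1 + y ^+ 2] at most
   [1 + 4 * M ^+ 2]; the second serves larger [|y|]. *)
pose C := pi * (1 + 4 * M ^+ 2) + 8 * (b - a).
exists C.
  have := pi_ge0 R; have := sqr_ge0 M; rewrite /C => ? ?.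
  by rewrite addr_ge0 ?mulr_ge0 ?subr_ge0 ?(ltW ab)//; lra.
move=> e y e0 e1; rewrite (ger0_norm (atan_window_ge0 _ e0 (ltW ab))).
have y0 : 0 < 1 + y ^+ 2 by rewrite ltr_wpDr ?sqr_ge0.
rewrite ler_pdivlMr//.
have [yM|My] := leP `|y| (2 * M).
  have yM2 : y ^+ 2 <= 4 * M ^+ 2.
    rewrite -real_normK ?num_real//.
    have -> : 4 * M ^+ 2 = (2 * M) ^+ 2 by ring.
    by rewrite lerXn2r ?nnegrE// mulr_ge0// (le_trans ler01).
  rewrite /C; have := atan_window_le_pi a b e y.
  have := atan_window_ge0 y e0 (ltW ab); have := pi_ge0 R.
  move: (atan_window a b e y) => w ? ? ?; nra.
have dF x := @is_derive_atan_scaled R y e x e0.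
pose F (x : R) := e * atan ((x - y) / e).
have cF : {within `[a, b], continuous F}.
  apply: continuous_subspaceT => x.
  by apply/differentiable_continuous/derivable1_diffP; have [] := dF x.
(* Far from [[a, b]] the window is [b - a] times the kernel at some [c] in the interval. As
   [|c| <= M] and [2 * M < |y|], the distance from [y] to [c] is at least [|y| / 2]. *)
have [c cab] := MVT ab (fun x _ => dF x) cF.
rewrite -/(atan_window a b e y) -mulrBr => wE.
have {}wE : atan_window a b e y = e / (e ^+ 2 + (y - c) ^+ 2) * (b - a).
  by apply: (mulfI (lt0r_neq0 e0)); rewrite wE expr2; ring.
have cM : `|c| <= M.
  move: cab; rewrite in_itv/= ler_norml => /andP[ac cb].
  have := ler_norm b; have := ler_normr `|a| (- a); have := normr_ge0 a; have := normr_ge0 b.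
  have := ler_norm (- a); rewrite normrN /M => ? ? ? ? ?; apply/andP; split; lra.
have yc : (`|y| / 2) ^+ 2 <= (y - c) ^+ 2.
  rewrite -[leRHS]real_normK ?num_real// lerXn2r ?nnegrE//.
  by have := lerB_dist y c; lra.
have y2 : `|y| ^+ 2 = y ^+ 2 by rewrite real_normK ?num_real.
have y1 : 1 <= y ^+ 2 by rewrite -y2; nra.
(* Since [1 <= y ^+ 2], the left side is at most [2 * y ^+ 2], and [y ^+ 2] is at most four times
   the square of [y - c]. *)
have q : 1 + y ^+ 2 <= 8 * (e ^+ 2 + (y - c) ^+ 2).
  by have := sqr_ge0 e; move: yc; rewrite expr_div_n y2; lra.
rewrite wE.
have Q0 : 0 < e ^+ 2 + (y - c) ^+ 2 by lra.
apply: (@le_trans _ _ (8 * (b - a))); last first.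
  by rewrite /C lerDr mulr_ge0 ?pi_ge0//; have := sqr_ge0 M; lra.
rewrite mulrAC ler_wpM2r ?subr_ge0 ?(ltW ab)// mulrAC ler_pdivrMr//.
by apply: le_trans q; rewrite ler_piMl// ltW.
Qed.

(** The signs treat all positions of [y] at once: for [a < b] the limit is [pi] inside the interval,
    [pi / 2] at its end points and 0 outside. Hence the convergence holds at every point. *)
Lemma cvg_atan_window (R : realType) (a b y : R) :
  atan_window a b (n.+1%:R^-1) y @[n --> \oo] -->
  pi / 2 * (Num.sg (b - y) - Num.sg (a - y)).
Proof.
have cn : (n.+1%:R : R) @[n --> \oo] --> +oo.
  by have := @cvgr_idn R; rewrite -cvg_shiftS.
have pos (z : R) : 0 < z -> atan (z * n.+1%:R) @[n --> \oo] --> pi / 2.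
  move=> z0; apply: (cvg_comp (fun n => n.+1%:R) (fun x => atan (z * x)) cn).
  have zy : z * x @[x --> +oo] --> +oo by apply: gt0_cvgMry z0 _; exact: cvg_id.
  exact: (cvg_comp (fun x => z * x) (@atan R) zy (@cvgy_atan R)).
have h (z : R) : atan (z / n.+1%:R^-1) @[n --> \oo] --> pi / 2 * Num.sg z.
  under eq_fun do rewrite invrK.
  have [->|z0|z0] := sgrP z.
  - by under eq_fun do rewrite mul0r atan0; rewrite mulr0; exact: cvg_cst.
  - by rewrite mulr1; exact: pos.
  - rewrite mulrN1 (_ : (fun n => _) = (fun n => - atan (- z * n.+1%:R))).
      by apply: cvgN; apply: pos; rewrite oppr_gt0.
    by apply/funext => n; rewrite mulNr atanN opprK.
by rewrite mulrBr; apply: cvgB; exact: h.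
Qed.

(** * Real transforms and their pairing with a modulated exponential *)

Definition cos_transform (R : realType) (g : R -> R) (k : R) : R :=
  \int[lebesgue_measure]_y (g y * cos (k * y)).

Definition sin_transform (R : realType) (g : R -> R) (k : R) : R :=
  \int[lebesgue_measure]_y (g y * sin (k * y)).

Lemma measurable_cos_transform (R : realType) (g : R -> R) :
  measurable_fun [set: R] g -> measurable_fun [set: R] (cos_transform g).
Proof.
move=> mg; apply: (@measurable_fun_Rintegral _ _ (measurableTypeR R)
  (measurableTypeR R) _ (@lebesgue_measure R) (fun z => g z.2 * cos (z.1 * z.2))).
apply: measurable_funM; first exact: (measurableT_comp mg).
by have [] := measurable_sin_cos_mul R.
Qed.

Lemma measurable_sin_transform (R : realType) (g : R -> R) :
  measurable_fun [set: R] g -> measurable_fun [set: R] (sin_transform g).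
Proof.
move=> mg; apply: (@measurable_fun_Rintegral _ _ (measurableTypeR R)
  (measurableTypeR R) _ (@lebesgue_measure R) (fun z => g z.2 * sin (z.1 * z.2))).
apply: measurable_funM; first exact: (measurableT_comp mg).
by have [] := measurable_sin_cos_mul R.
Qed.

(** The kernel is written as an integral over frequencies, the two integrals are exchanged, and the
    cosine of [k * (y - x)] is expanded. *)
Lemma Rintegral_poisson_transform (R : realType) (g : R -> R) (e x : R) :
  0 < e -> lebesgue_measure.-integrable [set: R] (EFin \o g) ->
  \int[lebesgue_measure]_y (g y * (e ^+ 2 / (e ^+ 2 + (y - x) ^+ 2))) =
  \int[lebesgue_measure]_k (exponential_pdf e k *
    (cos_transform g k * cos (k * x) + sin_transform g k * sin (k * x))).
Proof.
move=> e0 ig.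
have mcos (k : R) : measurable_fun [set: R] (fun y : R => cos (k * y)).
  by apply: measurable_fun_cos; exact: measurable_funM.
have msin (k : R) : measurable_fun [set: R] (fun y : R => sin (k * y)).
  by apply: measurable_fun_sin; exact: measurable_funM.
have igc (k : R) := integrableM_bounded ig (mcos k) (fun y => cos_max (k * y)).
have igs (k : R) := integrableM_bounded ig (msin k) (fun y => sin_max (k * y)).
transitivity (\int[lebesgue_measure]_y (g y *
    \int[lebesgue_measure]_k (exponential_pdf e k * cos (k * (y - x))))).
  by apply: eq_Rintegral => y _; rewrite Rintegral_exponential_cos.
rewrite -(@Rintegral_swap _ _ _ _ _ (@lebesgue_measure R) (@lebesgue_measure R)
  (exponential_pdf e) g (fun z => cos (z.1 * (z.2 - x)))).
- apply: eq_Rintegral => k _; congr (_ * _).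
  rewrite /cos_transform /sin_transform -(RintegralZr _ measurableT (igc k)).
  rewrite -(RintegralZr _ measurableT (igs k)) -RintegralD//.
  + by apply: eq_Rintegral => y _; rewrite /= mulrBr cosB mulrDr !mulrA.
  + by apply: (integrableM_bounded (k := fun=> cos (k * x)) (M := 1) (igc k)) => // _; exact: cos_max.
  + by apply: (integrableM_bounded (k := fun=> sin (k * x)) (M := 1) (igs k)) => // _; exact: sin_max.
- exact: integrable_exponential_pdf.
- exact: ig.
- apply: measurable_fun_cos.
  by apply: measurable_funM => //; exact: measurable_funB.
- by move=> z; exact: cos_max.
Qed.

(** The density lies between 0 and [e], so its square is at most [e] times the density itself, which
    is integrable. *)
Lemma Lnorm2_exponential_pdf_lty (R : realType) (e : R) : 0 < e ->
  ('N[@lebesgue_measure R]_2%:E[EFin \o exponential_pdf e] < +oo)%E.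
Proof.
move=> e0; rewrite unlock poweR_lty//.
have /integrableP[m i] := integrable_exponential_pdf e0.
have mp : measurable_fun [set: R] (exponential_pdf e) by exact/measurable_EFinP.
apply: (@le_lt_trans _ _ (\int[lebesgue_measure]_x (e%:E * `|(exponential_pdf e x)%:E|))%E).
  apply: ge0_le_integral => //=.
  - by apply/measurable_EFinP; exact: measurable_normr_powR.
  - by apply/measurable_EFinP; apply: measurable_funM => //; exact: measurableT_comp.
  - move=> x _; rewrite lee_fin powR_mulrn// expr2 ler_wpM2r//.
    rewrite ger0_norm ?exponential_pdf_ge0 ?(ltW e0)//.
    rewrite /exponential_pdf patchE; case: ifPn => [|_]; last exact: ltW.
    rewrite inE/= in_itv/= andbT => x0.
    by rewrite ler_piMr ?(ltW e0)// -expR0 ler_expR mulNr oppr_le0 mulr_ge0// ltW.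
rewrite ge0_integralZl//.
- by rewrite lte_mul_pinfty// lee_fin ltW.
- by apply: measurableT_comp.
- by rewrite lee_fin ltW.
Qed.

Lemma le_normr_fine (R : realDomainType) (x : \bar R) : (`|fine x|%:E <= `|x|)%E.
Proof. by case: x => //= ; rewrite normr0 leey. Qed.

(** Hölder's inequality with both exponents 2, then Minkowski's. The modulating factors are at most
    1 in modulus, which makes the bound independent of [x]. *)
Lemma Rintegral_poisson_le (R : realType) (g : R -> R) (e x : R) :
  0 < e -> lebesgue_measure.-integrable [set: R] (EFin \o g) ->
  (`|\int[lebesgue_measure]_y (g y * (e ^+ 2 / (e ^+ 2 + (y - x) ^+ 2)))|%:E <=
    'N[@lebesgue_measure R]_2%:E[EFin \o exponential_pdf e] *
    ('N[@lebesgue_measure R]_2%:E[EFin \o cos_transform g] +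
     'N[@lebesgue_measure R]_2%:E[EFin \o sin_transform g]))%E.
Proof.
move=> e0 ig; rewrite Rintegral_poisson_transform//.
have mg : measurable_fun [set: R] g by apply/measurable_EFinP; exact: measurable_int ig.
have mc := measurable_cos_transform mg; have ms := measurable_sin_transform mg.
have mp := measurable_exponential_pdf e.
have mcos : measurable_fun [set: R] (fun k : R => cos (k * x)).
  by apply: measurable_fun_cos; exact: measurable_funM.
have msin : measurable_fun [set: R] (fun k : R => sin (k * x)).
  by apply: measurable_fun_sin; exact: measurable_funM.
pose A k := cos_transform g k * cos (k * x).
pose B k := sin_transform g k * sin (k * x).
have mA : measurable_fun [set: R] A by exact: measurable_funM.
have mB : measurable_fun [set: R] B by exact: measurable_funM.
have mAB : measurable_fun [set: R] (A \+ B) by exact: measurable_funD.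
apply: le_trans (le_normr_fine _) _.
apply: le_trans (le_abse_integral _ measurableT _) _.
  by apply/measurable_EFinP; exact: measurable_funM.
have -> : (\int[@lebesgue_measure R]_k
    `|(exponential_pdf e k * (A k + B k))%:E| =
    'N[@lebesgue_measure R]_1[EFin \o (exponential_pdf e \* (A \+ B))%R])%E.
  by rewrite Lnorm1.
have pq : 2^-1 + 2^-1 = 1 :> R by rewrite [RHS]splitr !div1r.
apply: le_trans (@hoelder _ _ _ (@lebesgue_measure R) _ _ 2 2 mp mAB _ _ pq) _ => //.
rewrite lee_wpmul2l ?Lnorm_ge0//.
have := @minkowski_EFin _ _ _ (@lebesgue_measure R) _ _ 2 mA mB.
rewrite ler1n => /(_ isT) /le_trans; apply.
rewrite leeD//; apply: le_Lnorm2 => //.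
- by move=> k; rewrite /A normrM ler_piMr// cos_max.
- by move=> k; rewrite /B normrM ler_piMr// sin_max.
Qed.

(** The preceding bound is integrated over base points in [[a, b]]; being uniform, it only gains the
    length of the interval. By Fubini the left side becomes an integral against the window. *)
Lemma Rintegral_atan_window_le (R : realType) (g : R -> R) (a b e : R) :
  0 < e -> a < b -> lebesgue_measure.-integrable [set: R] (EFin \o g) ->
  (`|\int[lebesgue_measure]_y (g y * (e * atan_window a b e y))|%:E <=
    ('N[@lebesgue_measure R]_2%:E[EFin \o exponential_pdf e] *
    ('N[@lebesgue_measure R]_2%:E[EFin \o cos_transform g] +
     'N[@lebesgue_measure R]_2%:E[EFin \o sin_transform g])) * (b - a)%:E)%E.
Proof.
move=> e0 ab ig; set N := (X in (_ <= X * _)%E).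
have mg : measurable_fun [set: R] g by apply/measurable_EFinP; exact: measurable_int ig.
(* The numerator [e ^+ 2] keeps the kernel below 1, as [Rintegral_swap] demands; this normalization
   accounts for the factor [e] in front of the window. *)
pose K (z : R * R) := e ^+ 2 / (e ^+ 2 + (z.2 - z.1) ^+ 2).
have den (u : R) : 0 < e ^+ 2 + u ^+ 2 by rewrite ltr_wpDr ?sqr_ge0// exprn_gt0.
have mK : measurable_fun [set: R * R] K.
  have cP : continuous (fun u : R => e ^+ 2 / (e ^+ 2 + u ^+ 2)).
    move=> u; apply: cvgM (cvg_cst _) _; apply: cvgV; first by rewrite gt_eqF.
    by apply: cvgD (cvg_cst _) _; exact: exprn_continuous.
  apply: (measurableT_comp (continuous_measurable_fun cP)).
  exact: measurable_funB.
have K1 z : `|K z| <= 1.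
  rewrite /K ger0_norm ?divr_ge0 ?sqr_ge0 ?(ltW (den _))//.
  by rewrite ler_pdivrMr// mul1r lerDl sqr_ge0.
have i1 : lebesgue_measure.-integrable [set: R] (EFin \o \1_(`[a, b]%classic : set R)).
  exact: integrable_indic_itv.
pose J x := \int[lebesgue_measure]_y (g y * K (x, y)).
have mJ : measurable_fun [set: R] J.
  apply: (@measurable_fun_Rintegral _ _ (measurableTypeR R) (measurableTypeR R) _
    (@lebesgue_measure R) (fun z => g z.2 * K z)).
  by apply: measurable_funM mK; exact: (measurableT_comp mg).
have -> : \int[lebesgue_measure]_y (g y * (e * atan_window a b e y)) =
    \int[lebesgue_measure]_x (\1_(`[a, b]%classic : set R) x * J x).
  rewrite (Rintegral_swap i1 ig mK K1); apply: eq_Rintegral => y _; congr (_ * _).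
  rewrite -Rintegral_poisson_kernel// Rintegral_mkcond.
  apply: eq_Rintegral => x _; rewrite patchE indicE; case: ifP => _.
    by rewrite mul1r.
  by rewrite mul0r.
apply: le_trans (le_normr_fine _) _.
apply: le_trans (le_abse_integral _ measurableT _) _.
  by apply/measurable_EFinP; exact: measurable_funM.
have N0 : (0 <= N)%E by rewrite mule_ge0 ?Lnorm_ge0// adde_ge0 ?Lnorm_ge0.
apply: (@le_trans _ _ (\int[@lebesgue_measure R]_x (N * (\1_(`[a, b]%classic : set R) x)%:E))%E).
  apply: ge0_le_integral => //=.
  - apply/measurable_EFinP; apply: measurableT_comp => //; exact: measurable_funM.
  - by apply: emeasurable_funM => //; exact/measurable_EFinP.
  - move=> x _; have i0 : 0 <= \1_(`[a, b]%classic : set R) x :> R by rewrite indicE.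
    rewrite normrM (ger0_norm i0) mulrC EFinM.
    by apply: lee_wpmul2r; [rewrite lee_fin|exact: Rintegral_poisson_le].
rewrite ge0_integralZl//; last exact/measurable_EFinP.
rewrite integral_indic//= setIT.
suff -> : (@lebesgue_measure R `[a, b]%classic = (b - a)%:E)%E by [].
by rewrite lebesgue_measure_itv/= lte_fin ab EFinB.
Qed.

(** * Limits for square-integrable functions *)

Lemma Rintegral_dominated_cvg d (T : measurableType d) (R : realType)
    (mu : {measure set T -> \bar R}) (f_ : nat -> T -> R) (f g : T -> R) :
  (forall n, measurable_fun [set: T] (f_ n)) -> measurable_fun [set: T] f ->
  (forall x, f_ n x @[n --> \oo] --> f x) ->
  mu.-integrable [set: T] (EFin \o g) -> (forall n x, `|f_ n x| <= g x) ->
  \int[mu]_x f_ n x @[n --> \oo] --> \int[mu]_x f x.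
Proof.
move=> mf_ mf ff ig fg.
have Eff x : (EFin \o f_ n) x @[n --> \oo] --> (EFin \o f) x.
  by apply: cvg_EFin; [exact: nearW|exact: ff].
have [ifin _ cv] := @dominated_convergence _ _ _ mu _ measurableT
  (fun n => EFin \o f_ n) (EFin \o f) (EFin \o g)
  (fun n => (measurable_EFinP _ _).2 (mf_ n)) ((measurable_EFinP _ _).2 mf)
  (aeW _ (fun x _ => Eff x)) ig
  (aeW _ (fun x n _ => fg n x)).
apply: fine_cvg; rewrite /Rintegral fineK; first exact: cv.
exact: (integrable_fin_num measurableT ifin).
Qed.

(** On an interval of finite length the function [1 + h ^+ 2] is integrable, and it dominates
    [|h|]. *)
Lemma Lfun2_integrable_itv (R : realType) (h : R -> R) (a b : R) :
  h \in Lfun (@lebesgue_measure R) 2%:E ->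
  lebesgue_measure.-integrable `[a, b] (EFin \o h).
Proof.
move=> h2; have mh : measurable_fun [set: R] h by have /sub_Lfun_mfun /set_mem := h2.
have i2 : lebesgue_measure.-integrable `[a, b] (EFin \o (fun x => h x ^+ 2)).
  by apply: integrableS (Lfun2_integrable_sqr h2).
have i1 : lebesgue_measure.-integrable `[a, b] (EFin \o cst (1 : R)).
  apply: measurable_bounded_integrable => //=.
    by rewrite lebesgue_measure_itv/=; case: ifPn => // _; rewrite -EFinB ltry.
  exact: bounded_cst.
apply: le_integrable (integrableD _ i1 i2) => //.
- by apply/measurable_EFinP; exact: measurable_funTS.
- move=> x _ /=; rewrite lee_fin [leRHS]ger0_norm ?addr_ge0 ?sqr_ge0//.
  by rewrite -(real_normK (num_real (h x))); nra.
Qed.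

Lemma Lfun2_integrable_restrict (R : realType) (h : R -> R) (a b : R) :
  h \in Lfun (@lebesgue_measure R) 2%:E ->
  lebesgue_measure.-integrable [set: R] (EFin \o (h \_ (`[a, b]%classic : set R))).
Proof.
move=> h2; rewrite -restrict_EFin.
have [+ _] := @integrable_mkcond _ _ _ (@lebesgue_measure R) _ (EFin \o h)
  (measurable_itv `[a, b]).
by apply; exact: Lfun2_integrable_itv.
Qed.

Lemma Lfun2_integrable_oneDsqrV (R : realType) (h : R -> R) :
  h \in Lfun (@lebesgue_measure R) 2%:E ->
  lebesgue_measure.-integrable [set: R] (EFin \o (fun y => h y * (1 + y ^+ 2)^-1)).
Proof.
move=> h2; have mh : measurable_fun [set: R] h by have /sub_Lfun_mfun /set_mem := h2.
have mo : measurable_fun [set: R] (fun y : R => (1 + y ^+ 2)^-1).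
  exact: continuous_measurable_fun (@continuous_oneDsqrV R).
apply: le_integrable (integrableD _ (Lfun2_integrable_sqr h2) (integrable_oneDsqrV R)) => //.
- by apply/measurable_EFinP; exact: measurable_funM.
- move=> x _ /=; rewrite lee_fin normrM.
  have q0 : 0 < (1 + x ^+ 2)^-1 by rewrite invr_gt0 ltr_wpDr ?sqr_ge0.
  have q1 : (1 + x ^+ 2)^-1 <= 1 by rewrite invf_le1 ?lerDl ?sqr_ge0// -invr_gt0.
  rewrite (gtr0_norm q0) (ger0_norm (addr_ge0 (sqr_ge0 (h x)) (ltW q0))).
  rewrite -(real_normK (num_real (h x))).
  (* Completing the square gives [u * q <= u ^+ 2 + q ^+ 2 / 4], and [q ^+ 2 <= q]. *)
  have key (u q : R) : 0 < q -> q <= 1 -> u * q <= u ^+ 2 + q.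
    by move=> ? ?; have := sqr_ge0 (u - q / 2); nra.
  exact: key.
Qed.

Lemma cvg_restrict_itv (R : realType) (h : R -> R) (y : R) :
  (h \_ `[- n%:R, n%:R]) y @[n --> \oo] --> h y.
Proof.
apply: cvg_near_cst; near=> n; rewrite patchE mem_set//= in_itv/= -ler_norml.
by near: n; exact: nbhs_infty_ger.
Unshelve. all: by end_near. Qed.

Section vanishing_transform.
Context {R : realType} (h : R -> R).
Hypothesis h2 : h \in Lfun (@lebesgue_measure R) 2%:E.
Let hn n := h \_ (`[- n%:R, n%:R]%classic : set R).
Hypothesis cos0 :
  ('N[@lebesgue_measure R]_2%:E[EFin \o cos_transform (hn n)])%E @[n --> \oo] --> 0%E.
Hypothesis sin0 :
  ('N[@lebesgue_measure R]_2%:E[EFin \o sin_transform (hn n)])%E @[n --> \oo] --> 0%E.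

Let mh : measurable_fun [set: R] h.
Proof. by have /sub_Lfun_mfun /set_mem := h2. Qed.

Let ihn n : lebesgue_measure.-integrable [set: R] (EFin \o hn n).
Proof. exact: Lfun2_integrable_restrict. Qed.

Let mhn n : measurable_fun [set: R] (hn n).
Proof. by apply/measurable_EFinP; exact: measurable_int (ihn n). Qed.

Let iG (C : R) : lebesgue_measure.-integrable [set: R]
  (EFin \o (fun y => C * `|h y * (1 + y ^+ 2)^-1|)).
Proof.
have := integrableZl measurableT C (integrable_norm (Lfun2_integrable_oneDsqrV h2)).
exact.
Qed.

Let hnh n y : `|hn n y| <= `|h y|.
Proof. by rewrite /hn patchE; case: ifP => _; rewrite ?normr0. Qed.

(** The integrals for the truncations have two limits as [n] grows: the integral for [h], by
    dominated convergence, and 0, by the bound through the transforms. *)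
Lemma Rintegral_mul_atan_window_eq0 (a b e : R) : a < b -> 0 < e -> e <= 1 ->
  \int[lebesgue_measure]_y (h y * atan_window a b e y) = 0.
Proof.
move=> ab e0 e1.
have mw : measurable_fun [set: R] (atan_window a b e).
  by apply: continuous_measurable_fun; exact: continuous_atan_window.
have [C C0 wC] := atan_window_bound ab.
have cv : \int[lebesgue_measure]_y (hn n y * atan_window a b e y) @[n --> \oo] -->
    \int[lebesgue_measure]_y (h y * atan_window a b e y).
  apply: (Rintegral_dominated_cvg _ _ _ (iG C)).
  - by move=> n; apply: measurable_funM => //; exact: mhn.
  - exact: measurable_funM.
  - by move=> y; apply: cvgM; [exact: cvg_restrict_itv|exact: cvg_cst].
  - move=> n y; rewrite normrM normrM mulrCA ler_pM//.
    by rewrite (le_trans (wC e y e0 e1))// ler_wpM2l// ler_norm.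
have cv0 : \int[lebesgue_measure]_y (hn n y * atan_window a b e y) @[n --> \oo] --> (0 : R).
  pose B n := ('N[@lebesgue_measure R]_2%:E[EFin \o exponential_pdf e] *
    ('N[@lebesgue_measure R]_2%:E[EFin \o cos_transform (hn n)] +
     'N[@lebesgue_measure R]_2%:E[EFin \o sin_transform (hn n)]) * (b - a)%:E)%E.
  have B0 : B n @[n --> \oo] --> 0%E.
    have := cvgeD _ cos0 sin0; rewrite adde0 => /(_ _ isT) NN0.
    have pf : ('N[@lebesgue_measure R]_2%:E[EFin \o exponential_pdf e] \is a fin_num)%E.
      by rewrite ge0_fin_numE ?Lnorm_ge0//; exact: Lnorm2_exponential_pdf_lty.
    have := cvgeZl pf NN0; rewrite mule0 => PN0.
    have := cvgeZr (erefl : (b - a)%:E \is a fin_num) PN0; rewrite mul0e.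
    exact.
  have le n : (`|e * \int[lebesgue_measure]_y (hn n y * atan_window a b e y)|%:E <= B n)%E.
    have := Rintegral_atan_window_le e0 ab (ihn n).
    under eq_Rintegral do rewrite mulrCA.
    rewrite RintegralZl//.
    apply: (integrableM_bounded (M := pi) (ihn n) mw) => y.
    by rewrite ger0_norm ?atan_window_le_pi ?atan_window_ge0// ltW.
  have : (fun n => `|e * \int[lebesgue_measure]_y (hn n y * atan_window a b e y)|%:E)
     @ \oo --> 0%E.
    by apply: (squeeze_cvge _ (cvg_cst _) B0); apply: nearW => n; rewrite lee_fin normr_ge0/=.
  move=> /fine_cvgP[_] /norm_cvg0P eI0.
  (* The height stays fixed while [n] grows, so the factor [e] inherited from the bound can be
     divided out. *)
  pose J n := \int[lebesgue_measure]_y (hn n y * atan_window a b e y).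
  have : e^-1 * (e * J n) @[n --> \oo] --> e^-1 * 0.
    by apply: cvgM; [exact: cvg_cst|exact: eI0].
  rewrite mulr0 (_ : (fun n => e^-1 * (e * J n)) = J)//.
  by apply/funext => n; rewrite mulKf ?gt_eqF.
exact: cvg_unique cv cv0.
Qed.

(** The height now tends to 0 along the values [n.+1%:R^-1], which are positive and at most 1; the
    integral against the limiting window therefore vanishes too. *)
Lemma Rintegral_itv_eq0 (a b : R) : a < b ->
  \int[lebesgue_measure]_(y in `[a, b]) h y = 0.
Proof.
move=> ab.
have [C C0 wC] := atan_window_bound ab.
pose L (y : R) := pi / 2 * (Num.sg (b - y) - Num.sg (a - y)).
have mw n : measurable_fun [set: R] (atan_window a b n.+1%:R^-1).
  by apply: continuous_measurable_fun; exact: continuous_atan_window.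
have mL : measurable_fun [set: R] L.
  apply: (measurable_fun_cvg mw) => y _; exact: cvg_atan_window.
have cv : \int[lebesgue_measure]_y (h y * atan_window a b n.+1%:R^-1 y) @[n --> \oo] -->
    \int[lebesgue_measure]_y (h y * L y).
  apply: (Rintegral_dominated_cvg _ _ _ (iG C)).
  - by move=> n; apply: measurable_funM => //; exact: mw.
  - exact: measurable_funM.
  - by move=> y; apply: cvgM; [exact: cvg_cst|exact: cvg_atan_window].
  - move=> n y; rewrite normrM normrM mulrCA ler_pM//.
    have n1 : n.+1%:R^-1 <= 1 :> R by rewrite invf_le1 ?ler1n ?ltr0n.
    by rewrite (le_trans (wC _ y _ n1)) ?invr_gt0 ?ltr0n// ler_wpM2l// ler_norm.
have hL0 : \int[lebesgue_measure]_y (h y * L y) = 0.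
  have E n : \int[lebesgue_measure]_y (h y * atan_window a b n.+1%:R^-1 y) = 0.
    by apply: Rintegral_mul_atan_window_eq0 => //; rewrite invf_le1 ?ler1n ?ltr0n.
  have cv0 : \int[lebesgue_measure]_y (h y * atan_window a b n.+1%:R^-1 y)
      @[n --> \oo] --> (0 : R).
    by under eq_fun do rewrite E; exact: cvg_cst.
  exact: cvg_unique cv cv0.
have iab := Lfun2_integrable_restrict a b h2.
have : \int[lebesgue_measure]_y (h y * L y) =
    \int[lebesgue_measure]_y ((h \_ (`[a, b]%classic : set R)) y * pi).
  congr fine; apply: ae_eq_integral => //.
  - by apply/measurable_EFinP; exact: measurable_funM.
  - apply/measurable_EFinP; apply: measurable_funM => //.
    by apply/measurable_EFinP; exact: measurable_int iab.
  - have FF := ae_filter_ringOfSetsType (@lebesgue_measure R).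
    (* The limiting window differs from [pi] times the indicator of [[a, b]] only at the end points,
       where it is [pi / 2]. *)
    apply: filterS2 (lebesgue_ae_neq a) (lebesgue_ae_neq b) => y ya yb _; congr EFin.
    rewrite patchE /L; case: ifPn.
      rewrite inE/= in_itv/= => /andP[ay yb'].
      rewrite gtr0_sg ?subr_gt0 ?lt_neqAle ?yb//.
      by rewrite ltr0_sg ?subr_lt0 ?lt_neqAle 1?eq_sym ?ya//; field.
    rewrite notin_setE/= in_itv/= => /negP; rewrite negb_and -!ltNge mul0r.
    case/orP => [ya'|yb'].
      by rewrite !gtr0_sg ?subr_gt0 ?(lt_trans ya' ab)// subrr !mulr0.
    by rewrite !ltr0_sg ?subr_lt0 ?(lt_trans ab yb')// subrr !mulr0.
rewrite hL0 RintegralZr// -Rintegral_mkcond => /esym/eqP.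
by rewrite mulf_eq0 [pi == 0]gt_eqF ?pi_gt0// orbF => /eqP.
Qed.

Lemma vanishing_transform_ae_eq0 : h = (fun=> 0) %[ae @lebesgue_measure R].
Proof.
apply: ae_eq0_Rintegral_itv => // a b; [exact: Lfun2_integrable_itv|].
exact: Rintegral_itv_eq0.
Qed.

End vanishing_transform.

(** * From the complex transform of real functions to the real transforms *)

Lemma truncate_real (R : realType) (h : R -> R) (n : nat) (y : R) :
  truncate (fun x => (h x)%:C%C) n y =
  ((h \_ (`[- n%:R, n%:R]%classic : set R)) y)%:C%C.
Proof. by rewrite /truncate patchE mem_setE; case: ifP. Qed.

Lemma fourier_truncate_real (R : realType) (h : R -> R) (n : nat) (k : R) :
  let hn := h \_ (`[- n%:R, n%:R]%classic : set R) in
  fourier (truncate (fun x => (h x)%:C%C) n) k =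
  Complex (cos_transform hn k) (sin_transform hn k).
Proof.
move=> hn; congr Complex; apply: eq_Rintegral => y _.
- by rewrite truncate_real complex_ReM /= mul0r subr0.
- by rewrite truncate_real complex_ImM /= mul0r addr0.
Qed.

Lemma cos_transformB (R : realType) (f g : R -> R) (k : R) :
  lebesgue_measure.-integrable [set: R] (EFin \o f) ->
  lebesgue_measure.-integrable [set: R] (EFin \o g) ->
  cos_transform (f \- g) k = cos_transform f k - cos_transform g k.
Proof.
move=> fi gi; have mc : measurable_fun [set: R] (fun y : R => cos (k * y)).
  by apply: measurable_fun_cos; exact: measurable_funM.
rewrite /cos_transform -RintegralB//.
- by apply: eq_Rintegral => y _; rewrite /= mulrBl.
- exact: integrableM_bounded fi mc (fun y => cos_max (k * y)).
- exact: integrableM_bounded gi mc (fun y => cos_max (k * y)).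
Qed.

Lemma sin_transformB (R : realType) (f g : R -> R) (k : R) :
  lebesgue_measure.-integrable [set: R] (EFin \o f) ->
  lebesgue_measure.-integrable [set: R] (EFin \o g) ->
  sin_transform (f \- g) k = sin_transform f k - sin_transform g k.
Proof.
move=> fi gi; have mc : measurable_fun [set: R] (fun y : R => sin (k * y)).
  by apply: measurable_fun_sin; exact: measurable_funM.
rewrite /sin_transform -RintegralB//.
- by apply: eq_Rintegral => y _; rewrite /= mulrBl.
- exact: integrableM_bounded fi mc (fun y => sin_max (k * y)).
- exact: integrableM_bounded gi mc (fun y => sin_max (k * y)).
Qed.

(** The triangle inequality through the common limit, with [f] put in place of [g] by almost
    everywhere equality. *)
Lemma Lnorm2_cvg_sub0 d (T : measurableType d) (R : realType)
    (mu : {measure set T -> \bar R}) (A B : nat -> T -> R) (f g : T -> R) :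
  (forall n, measurable_fun [set: T] (A n)) ->
  (forall n, measurable_fun [set: T] (B n)) ->
  measurable_fun [set: T] f -> measurable_fun [set: T] g -> f = g %[ae mu] ->
  ('N[mu]_2%:E[EFin \o (A n \- f)%R])%E @[n --> \oo] --> 0%E ->
  ('N[mu]_2%:E[EFin \o (B n \- g)%R])%E @[n --> \oo] --> 0%E ->
  ('N[mu]_2%:E[EFin \o (A n \- B n)%R])%E @[n --> \oo] --> 0%E.
Proof.
move=> mA mB mf mg fg Af Bg.
have := cvgeD _ Af Bg; rewrite adde0 => /(_ _ isT) S0.
apply: (squeeze_cvge _ (cvg_cst _) S0); apply: nearW => n.
rewrite Lnorm_ge0/= (Lnorm2_subC mu (A n) f).
rewrite (_ : 'N[mu]_2%:E[EFin \o (B n \- g)%R] = 'N[mu]_2%:E[EFin \o (f \- B n)%R])%E.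
  exact: Lnorm2_subr.
rewrite Lnorm2_subC; apply: ae_eq_Lnorm2.
- exact: measurable_funB.
- exact: measurable_funB.
- by apply: filterS fg => x /(_ I) e _ /=; rewrite e.
Qed.

(** The vanishing result is applied to [h1 \- h2]. Linearity is used only on the truncations, which
    are integrable, so that their transforms are genuine integrals that may be subtracted. *)
Lemma is_fourierL2_inj (R : realType) (h1 h2 : R -> R) (H1 H2 : R -> R[i]) :
  h1 \in Lfun (@lebesgue_measure R) 2%:E ->
  h2 \in Lfun (@lebesgue_measure R) 2%:E ->
  is_fourierL2 (fun x => (h1 x)%:C%C) H1 -> is_fourierL2 (fun x => (h2 x)%:C%C) H2 ->
  H1 = H2 %[ae @lebesgue_measure R] -> h1 = h2 %[ae @lebesgue_measure R].
Proof.
move=> L1 L2 F1 F2 H12.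
have [[cr1 ci1] [cr2 ci2]] := (is_fourierL2_cvg F1, is_fourierL2_cvg F2).
have [_ /cL2_measurable [mH1r mH1i] _] := F1.
have [_ /cL2_measurable [mH2r mH2i] _] := F2.
pose I n := (`[- n%:R, n%:R]%classic : set R).
have mF (h : R -> R) (n : nat) : cL2 (fun x => (h x)%:C%C) ->
    cmeasurable_fun [set: R] (fourier (truncate (fun x => (h x)%:C%C) n)).
  by move=> /cL2_measurable mh; apply: measurable_fourier; exact: measurable_truncate.
have [C1 _ _] := F1; have [C2 _ _] := F2.
have L12 : h1 \- h2 \in Lfun (@lebesgue_measure R) 2%:E.
  have le12 : (1 <= 2%:E :> \bar R)%E by rewrite lee_fin ler1n.
  have [_ /(_ (-1) h2 h1 L2 L1)] := Lfun_submod_closed (@lebesgue_measure R) le12.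
  rewrite (_ : _ + _ = h1 \- h2)//.
  by apply/funext => x; rewrite scaleN1r addrC.
have hnE n : (h1 \- h2) \_ (I n) = h1 \_ (I n) \- h2 \_ (I n).
  by apply/funext => y /=; rewrite !patchE; case: ifP; rewrite ?subrr.
have i1 n := Lfun2_integrable_restrict (- n%:R) n%:R L1.
have i2 n := Lfun2_integrable_restrict (- n%:R) n%:R L2.
have r12 : (fun k => complex.Re (H1 k)) = (fun k => complex.Re (H2 k))
    %[ae @lebesgue_measure R].
  have FF := ae_filter_ringOfSetsType (@lebesgue_measure R).
  by apply: filterS H12 => k /(_ Logic.I) -> _.
have i12 : (fun k => complex.Im (H1 k)) = (fun k => complex.Im (H2 k))
    %[ae @lebesgue_measure R].
  have FF := ae_filter_ringOfSetsType (@lebesgue_measure R).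
  by apply: filterS H12 => k /(_ Logic.I) -> _.
have c0 : ('N[@lebesgue_measure R]_2%:E[EFin \o cos_transform ((h1 \- h2)%R \_ (I n))])%E
    @[n --> \oo] --> 0%E.
  have := Lnorm2_cvg_sub0 (mu := @lebesgue_measure R) (fun n => (mF h1 n C1).1)
    (fun n => (mF h2 n C2).1) mH1r mH2r r12 cr1 cr2.
  apply: cvg_trans; apply: near_eq_cvg; apply: nearW => n; congr Lnorm.
  apply/funext => k; congr EFin; rewrite hnE (cos_transformB _ (i1 n) (i2 n)).
  by congr (_ - _); rewrite fourier_truncate_real.
have s0 : ('N[@lebesgue_measure R]_2%:E[EFin \o sin_transform ((h1 \- h2)%R \_ (I n))])%E
    @[n --> \oo] --> 0%E.
  have := Lnorm2_cvg_sub0 (mu := @lebesgue_measure R) (fun n => (mF h1 n C1).2)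
    (fun n => (mF h2 n C2).2) mH1i mH2i i12 ci1 ci2.
  apply: cvg_trans; apply: near_eq_cvg; apply: nearW => n; congr Lnorm.
  apply/funext => k; congr EFin; rewrite hnE (sin_transformB _ (i1 n) (i2 n)).
  by congr (_ - _); rewrite fourier_truncate_real.
have := vanishing_transform_ae_eq0 L12 c0 s0.
have FF := ae_filter_ringOfSetsType (@lebesgue_measure R).
by apply: filterS => x /(_ Logic.I) /eqP; rewrite subr_eq0 => /eqP.
Qed.

(** * The equation at a fixed frequency *)

(* The velocity v = w' solves the homogeneous equation v' = a v, so |v|^2 is
   nonincreasing; it takes the value |F|^2 at both times where w vanishes, and
   by Rolle its derivative 2 Re a |v|^2 vanishes somewhere in between. *)
Lemma affine_ode_source_eq0 (R : realType) (T : R) (a F : R[i]) (w : R -> R[i]) :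
  0 < T -> complex.Re a < 0 -> ccontinuous_in `[0, +oo[ w ->
  (forall t, 0 < t -> is_cderive t w (a * w t + F)) ->
  w 0 = 0 -> w T = 0 -> F = 0.
Proof.
move=> T0; case: a F => ar ai [Fr Fi] /= ar0 [cp cq] dw w0 wT.
pose p t := complex.Re (w t); pose q t := complex.Im (w t).
(* The velocity is taken as the right-hand side of the equation, not as a derivative: it is then
   defined and continuous at time 0 as well, where [w] is only continuous. *)
pose vr t := ar * p t - ai * q t + Fr; pose vi t := ar * q t + ai * p t + Fi.
pose phi t := vr t ^+ 2 + vi t ^+ 2.
have dp (t : R) : 0 < t -> is_derive t (1 : R) p (vr t).
  by move=> /dw[+ _]; rewrite /vr /p /q; case: (w t).
have dq (t : R) : 0 < t -> is_derive t (1 : R) q (vi t).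
  by move=> /dw[_ +]; rewrite /vi /p /q; case: (w t).
have dphi (t : R) : 0 < t -> is_derive t (1 : R) phi (2 * ar * phi t).
  move=> t0; have dpt := dp t t0; have dqt := dq t t0.
  rewrite /phi /vr /vi; apply: is_derive_eq.
  rewrite /GRing.scale /= -/(vr t) -/(vi t).
  ring.
have phi0 : phi 0 = Fr ^+ 2 + Fi ^+ 2.
  by rewrite /phi /vr /vi /p /q w0 /= !mulr0 subr0 addr0 !add0r.
have phiT : phi T = Fr ^+ 2 + Fi ^+ 2.
  by rewrite /phi /vr /vi /p /q wT /= !mulr0 subr0 addr0 !add0r.
have sub0T : `[0, T] `<=` `[0, +oo[ by apply: subset_itvl.
have cphi : {within `[0, T], continuous phi}.
  have cp' := continuous_subspaceW sub0T cp; have cq' := continuous_subspaceW sub0T cq.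
  have cvr : {within `[0, T], continuous vr}.
    move=> x; apply: cvgD (cvg_cst _).
    apply: cvgB; [exact: cvgM (cvg_cst _) (cp' x)|exact: cvgM (cvg_cst _) (cq' x)].
  have cvi : {within `[0, T], continuous vi}.
    move=> x; apply: cvgD (cvg_cst _).
    apply: cvgD; [exact: cvgM (cvg_cst _) (cq' x)|exact: cvgM (cvg_cst _) (cp' x)].
  have -> : phi = (fun t => vr t * vr t + vi t * vi t).
    by apply/funext => t; rewrite /phi !expr2.
  by move=> x; apply: cvgD; apply: cvgM; (exact: cvr || exact: cvi).
have ephi x : x \in `]0, T[ -> derivable phi x 1.
  by rewrite in_itv/= => /andP[x0 _]; have [] := dphi x x0.
have [c cT /@derive_val dc0] := Rolle T0 ephi cphi (etrans phi0 (esym phiT)).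
have c0 : 0 < c by move: cT; rewrite in_itv/= => /andP[].
have := @derive_val _ _ _ _ _ _ _ (dphi c c0); rewrite dc0 => /esym/eqP.
rewrite !mulf_eq0 pnatr_eq0 /= lt_eqF//= => /eqP phic.
(* As [phi] is nonincreasing and vanishes at [c], its value at [T], the squared modulus of the
   source, is at most 0. *)
have : phi T <= phi c.
  apply: (ler0_derive1_le_cc ephi _ cphi).
  - move=> x; rewrite in_itv/= => /andP[x0 _].
    rewrite derive1E (@derive_val _ _ _ _ _ _ _ (dphi x x0)).
    by rewrite mulr_le0_ge0 ?addr_ge0 ?sqr_ge0// mulr_ge0_le0 // ltW.
  - by rewrite in_itv/= (ltW T0) lexx.
  - by move: cT; rewrite !in_itv/= => /andP[/ltW -> /ltW ->].
  - by move: cT; rewrite !in_itv/= => /andP[_ /ltW ->].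
rewrite phic phiT => h.
have [Fr0 Fi0] : Fr ^+ 2 = 0 /\ Fi ^+ 2 = 0.
  have := sqr_ge0 Fr; have := sqr_ge0 Fi.
  by split; apply/eqP; rewrite eq_le; apply/andP; split; lra.
by move/eqP: Fr0; move/eqP: Fi0; rewrite !sqrf_eq0 => /eqP -> /eqP ->.
Qed.

(** From [1 < alpha] one gets [|theta| < 1], so the angle lies strictly between [- pi / 2] and
    [pi / 2] for either sign of [k]. *)
Lemma Re_riesz_feller_symbol_gt0 (R : realType) (alpha theta k : R) :
  1 < alpha -> `|theta| <= Num.min alpha (2 - alpha) -> k != 0 ->
  0 < complex.Re (riesz_feller_symbol alpha theta k).
Proof.
move=> a1 th k0; rewrite /riesz_feller_symbol complex_ReM /= mul0r subr0.
apply: mulr_gt0; first by rewrite powR_gt0// normr_gt0.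
have th1 : `|theta| < 1.
  by apply: (le_lt_trans th); rewrite gt_min; apply/orP; right; lra.
rewrite cos_gt0_pihalf//.
have pi0 := pi_gt0 R.
move: th1; rewrite ltr_norml => /andP[h1 h2].
case: (sgrP k) k0 => // _ _; apply/andP; split; nra.
Qed.

Theorem theorem4p2p1 (R : realType) (alpha theta nu d T : R)
    (g0 f1 f2 : R -> R) (u1 u2 : R -> R -> R[i])
    (halpha1 : 1 < alpha) (halpha2 : alpha <= 2)
    (htheta : `|theta| <= Num.min alpha (2 - alpha))
    (hd : 0 < d) (hT : 0 < T)
    (hg0 : g0 \in Lfun (@lebesgue_measure R) 2%:E)
    (hf1 : f1 \in Lfun (@lebesgue_measure R) 2%:E)
    (hf2 : f2 \in Lfun (@lebesgue_measure R) 2%:E)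
    (hu1 : is_solution alpha theta nu d g0 f1 u1)
    (hu2 : is_solution alpha theta nu d g0 f2 u2)
    (hT12 : (fun x => u1 x T) = (fun x => u2 x T) %[ae @lebesgue_measure R]) :
  f1 = f2 %[ae @lebesgue_measure R].
Proof.
have [_ _ [uh1 [g1 [fh1 [Fg1 Ff1 _ Fu1 ode1]]]]] := hu1.
have [_ _ [uh2 [g2 [fh2 [Fg2 Ff2 _ Fu2 ode2]]]]] := hu2.
apply: (is_fourierL2_inj hf1 hf2 Ff1 Ff2).
(* Each solution comes with its own representative of the transform of [g0], hence the initial
   values match only at almost every frequency. *)
have eg : g1 = g2 %[ae @lebesgue_measure R].
  by apply: (is_fourierL2_unique Fg1 Fg2); exact: aeW.
have eT : (fun k => uh1 k T) = (fun k => uh2 k T) %[ae @lebesgue_measure R].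
  exact: (is_fourierL2_unique (Fu1 T (ltW hT)) (Fu2 T (ltW hT)) hT12).
have FF := ae_filter_ringOfSetsType (@lebesgue_measure R).
(* The frequency 0 is discarded with the other null sets: there the coefficient [a] is 0, whereas
   the argument requires a negative real part. *)
apply: filterS (filterI (filterI ode1 ode2) (filterI (filterI eg eT) (lebesgue_ae_neq 0))).
move=> k [[[c1 o1 i1] [c2 o2 i2]] [[/(_ I) e0 /(_ I) e1] kn0]] _.
set a := Complex 0 (nu * k) - _ in o1 o2.
apply/eqP; rewrite -subr_eq0; apply/eqP.
have reE : (fun t => complex.Re (uh1 k t - uh2 k t)) =
    (fun t => complex.Re (uh1 k t)) \- (fun t => complex.Re (uh2 k t)).
  by apply/funext => t; rewrite complex_ReB.
have imE : (fun t => complex.Im (uh1 k t - uh2 k t)) =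
    (fun t => complex.Im (uh1 k t)) \- (fun t => complex.Im (uh2 k t)).
  by apply/funext => t; rewrite complex_ImB.
apply: (@affine_ode_source_eq0 R T a _ (fun t => uh1 k t - uh2 k t)) => //.
- have := Re_riesz_feller_symbol_gt0 halpha1 htheta kn0.
  rewrite /a complex_ReB; move: (riesz_feller_symbol _ _ _) => z z0.
  by rewrite sub0r oppr_lt0 complex_ReM /= mul0r subr0 mulr_gt0.
- case: c1 c2 => [c1r c1i] [c2r c2i]; rewrite /ccontinuous_in reE imE; split.
  + by move=> t; apply: cvgB; [exact: c1r|exact: c2r].
  + by move=> t; apply: cvgB; [exact: c1i|exact: c2i].
- move=> t t0; have [d1r d1i] := o1 t t0; have [d2r d2i] := o2 t t0.
  have -> : a * (uh1 k t - uh2 k t) + (fh1 k - fh2 k) =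
      (a * uh1 k t + fh1 k) - (a * uh2 k t + fh2 k) by ring.
  rewrite /is_cderive reE imE complex_ReB complex_ImB.
  by split; exact: is_deriveB.
- by rewrite i1 i2 e0 subrr.
- by move: e1 => /= ->; rewrite subrr.
Qed.
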